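(* Let $p>3$ be a prime and $m,n\in R_p$ with $m\not\equiv 0\pmod p$. Then $$P_{[p/6]}\!\left(\frac{n}{2m^3}\right)\equiv \sum_{k=0}^{[p/6]}\binom{6k}{3k}\binom{3k}{k}\left(\frac{2m^3-n}{12^3m^3}\right)^k\equiv -\left(\frac{3m}{p}\right)\sum_{x=0}^{p-1}\left(\frac{x^3-3m^2x+n}{p}\right)\pmod p.$$ Here, in the middle sum, $\frac{2m^3-n}{12^3m^3}$ is an ordinary fraction, while in the last expression $\left(\frac{\cdot}{p}\right)$ denotes the Legendre symbol.
   Context: $R_p$ is the ring of rational numbers whose denominator is coprime to $p$; congruences modulo $p$ are in $R_p$. $\left(\frac{a}{p}\right)$ is the Legendre symbol, extended to $a\in R_p$ via the residue class of $a$ modulo $p$ (and equal to $0$ if $a\equiv 0 \pmod p$). $[x]$ is the greatest integer not exceeding $x$. $P_n(x)$ is the $n$-th Legendre polynomial: $P_0(x)=1$, $P_1(x)=x$, $(n+1)P_{n+1}(x)=(2n+1)xP_n(x)-nP_{n-1}(x)$ for $n\ge 1$. *)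

(* Defs.v *)
From mathcomp Require Import all_boot all_order all_algebra.

Set Implicit Arguments.
Unset Strict Implicit.
Unset Printing Implicit Defensive.

Import Order.TTheory GRing.Theory Num.Theory.

Local Open Scope ring_scope.

Definition Rp (p : nat) : {pred rat} := [pred a | coprime `|denq a| p].

(* Congruence modulo the ideal p R_p of R_p; both sides must lie in R_p. *)
Definition congr_Rp (p : nat) (a b : rat) : bool :=
  [&& a \in Rp p, b \in Rp p & (a - b) / p%:R \in Rp p].

Notation "a =_[ p ] b" := (congr_Rp p a b)
  (at level 70, p at level 50, format "a  =_[ p ]  b") : ring_scope.

(* For prime p and a in R_p, [ratr a : 'F_p] is numq a / denq a computed in
   'F_p, i.e. the residue class of a modulo p. *)
Definition legendre_symbol (p : nat) (a : rat) : int :=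
  let r : 'F_p := ratr a in
  if r == 0 then 0 else if [exists y : 'F_p, y ^+ 2 == r] then 1 else -1.

Fixpoint legendre_poly (n : nat) : {poly rat} :=
  match n with
  | 0 => 1
  | n'.+1 =>
    match n' with
    | 0 => 'X
    | n''.+1 =>
      (n'.+1%:R)^-1 *:
        ((2 * n' + 1)%:R *: ('X * legendre_poly n')
         - n'%:R *: legendre_poly n'')
    end
  end.

Lemma legendre_poly_rec (n : nat) : (1 <= n)%N ->
  n.+1%:R *: legendre_poly n.+1
  = (2 * n + 1)%:R *: ('X * legendre_poly n) - n%:R *: legendre_poly n.-1.
Proof.
case: n => // n _; rewrite [legendre_poly n.+2]/= scalerA divff ?scale1r //.
by rewrite pnatr_eq0.
Qed.

(* Main.v *)
Require Import Defs.
From mathcomp Require Import all_boot all_order all_algebra.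
From mathcomp Require Import cyclic finfield.
From mathcomp Require Import ring zify.

(** Everything takes place in 'F_p: the middle sum becomes a polynomial in the
    residues of m and n, and both congruences become identities in 'F_p. Put
    h = (p - 1) / 2 and N = [p / 6].

    For the first congruence, the Legendre polynomial expanded at 1 is the sum
    over k of C(N + k, 2k) C(2k, k) ((x - 1) / 2)^k
    ([horner_legendre_poly]). As a function of k the ratio of consecutive
    coefficients is (N(N + 1) - k(k + 1)) / (k + 1)^2, so that only N(N + 1)
    matters. Since p is 6N + 1 or 6N + 5, (6N + 1)(6N + 5) vanishes modulo p,
    that is 36 N(N + 1) = -5, and then the ratio is that of
    C(6k, 3k) C(3k, k) / (-432)^k ([legendre_coef_sextic]).

    For the second congruence, Euler's criterion turns each Legendre symbol into
    an h-th power. The cubic x^3 - 3 m^2 x + n differs from the nodal cubic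
    (x - m)^2 (x + 2m) by the constant n - 2m^3, so the translation
    x = y + m makes it y^2 (y + 3m) + (n - 2m^3). Summing a polynomial of small
    degree over a finite field with q elements extracts the coefficient of
    degree q - 1 up to sign ([sum_finField_horner]). In the expansion of
    (y^2 (y + 3m) + d)^h by powers of d, the coefficient of degree 2h of the
    k-th term is a single monomial with coefficient
    C(h, k) C(h - k, 2k) = C(h, 3k) C(3k, k) ([sum_nodal_cubic_exp]). Finally
    h is -1/2 modulo p, so C(h, j) is C(-1/2, j) = C(2j, j) / (-4)^j
    ([bin_half_central]), which for j = 3k gives C(6k, 3k). *)

Set Implicit Arguments.
Unset Strict Implicit.
Unset Printing Implicit Defensive.

Import Order.TTheory GRing.Theory Num.Theory.

Local Open Scope ring_scope.

(** * Power sums and squares in finite fields *)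

Lemma expf_card_pred (F : finFieldType) (x : F) : x != 0 -> x ^+ #|F|.-1 = 1.
Proof.
move=> x0; have q1 := finNzRing_gt1 F.
by apply: (mulfI x0); rewrite mulr1 -exprS prednK ?expf_card // ltnW.
Qed.

Lemma finField_has_prim_root (F : finFieldType) :
  exists g : F, #|F|.-1.-primitive_root g.
Proof.
have q1 : (1 < #|F|)%N := finNzRing_gt1 F.
have /hasP[g _ gP] : has #|F|.-1.-primitive_root (enum [pred x : F | x != 0]).
  apply: has_prim_root; first by lia.
  - apply/allP=> x; rewrite mem_enum inE => x0; apply/unity_rootP.
    exact: expf_card_pred.
  - exact: enum_uniq.
  - have <- : #|[pred x : F | x != 0]| = #|F|.-1 by have := cardC1 (0 : F).
    by rewrite cardE.
by exists g.
Qed.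

Lemma finField_natr_card (F : finFieldType) : #|F|%:R = 0 :> F.
Proof.
have: \sum_(x : F) (x + 1) = \sum_(x : F) x.
  by rewrite [RHS](reindex_inj (addIr 1)).
rewrite big_split /= sumr_const => /eqP.
by rewrite -subr_eq0 addrAC subrr add0r => /eqP.
Qed.

(** Multiplication by a primitive root g permutes the field and scales the
    sum by g ^+ e, which is not 1. *)
Lemma sum_expf_eq0 (F : finFieldType) (e : nat) :
  ~~ (#|F|.-1 %| e)%N -> \sum_(x : F) x ^+ e = 0.
Proof.
have [g gP] := finField_has_prim_root F; rewrite (prim_order_dvd gP) => ge.
have g0 : g != 0.
  apply/eqP => g0; have /eqP := prim_expr_order gP.
  by rewrite g0 expr0n (gtn_eqF (prim_order_gt0 gP)) eq_sym oner_eq0.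
have: (\sum_(x : F) x ^+ e) * (g ^+ e - 1) = 0.
  rewrite mulrBr mulr1 mulr_suml [X in _ - X](reindex_inj (mulIf g0)) /=.
  by under [X in _ - X]eq_bigr do rewrite exprMn; rewrite subrr.
by move/eqP; rewrite mulf_eq0 subr_eq0 (negPf ge) orbF => /eqP.
Qed.

(** Of the power sums of exponent less than 2(q - 1), where q = #|F|, only the
    one of exponent q - 1 survives, and it counts the q - 1 = -1 units. *)
Lemma sum_finField_horner (F : finFieldType) (f : {poly F}) :
  (size f <= (#|F|.-1).*2)%N -> \sum_(x : F) f.[x] = - f`_(#|F|.-1).
Proof.
set q1 := #|F|.-1; have q1_gt0 : (0 < q1)%N.
  by rewrite /q1; have := finNzRing_gt1 F; case: #|F| => [|[]].
move=> sf; under eq_bigr do rewrite (horner_coef_wide _ sf).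
rewrite exchange_big /=; under eq_bigr do rewrite -mulr_sumr.
have lt_q1 : (q1 < q1.*2)%N by lia.
rewrite (bigD1 (Ordinal lt_q1)) //= [X in _ + X]big1 ?addr0 => [|i].
  rewrite (bigD1 0) //= expr0n (gtn_eqF q1_gt0) add0r.
  under eq_bigr => x x0 do rewrite expf_card_pred //.
  rewrite sumr_const (_ : #|_| = q1); last by have := cardC1 (0 : F).
  rewrite (_ : q1%:R = -1) ?mulrN1 //; apply/eqP.
  by rewrite -addr_eq0 addrC -mulrS prednK ?finField_natr_card // /q1; lia.
rewrite -val_eqE /= => i_neq.
(* The power sum of exponent 0 is the number q = 0 of elements. *)
have [->|i_gt0] := posnP i.
  by under eq_bigr do rewrite expr0; rewrite sumr_const finField_natr_card mulr0.
rewrite sum_expf_eq0 ?mulr0 // -/q1; apply/dvdnP => -[k ik].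
have := ltn_ord i; move: i_neq i_gt0; rewrite ik.
by case: k {ik} => [|[|k]]; rewrite ?mul0n ?mul1n ?eqxx // => _ _; lia.
Qed.

(** A solution is g ^+ i for a primitive root g, and then h.*2 divides i * h,
    so that i is even. *)
Lemma square_of_expf_eq1 (F : finFieldType) (h : nat) (x : F) :
  #|F| = h.*2.+1 -> x ^+ h = 1 -> exists y, x = y ^+ 2.
Proof.
move=> card_F xh; have [g] := finField_has_prim_root F.
rewrite card_F /= => gP.
have x1 : x ^+ h.*2 = 1 by rewrite -mul2n mulnC exprM xh expr1n.
have [[i lti] /= xE] := prim_rootP gP x1.
have h_gt0 : (0 < h)%N by have := prim_order_gt0 gP; lia.
have : (h.*2 %| i * h)%N by rewrite (prim_order_dvd gP) exprM -xE xh.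
rewrite -mul2n dvdn_pmul2r // => /dvdnP[j ij].
by exists (g ^+ j); rewrite -exprM -ij.
Qed.

(** * Binomial identities *)

Lemma bin_mul_trinomial n k m :
  ('C(n, k) * 'C(n - k, m) = 'C(n, k + m) * 'C(k + m, k))%N.
Proof.
have [le_n|lt_n] := leqP (k + m) n; last first.
  rewrite ['C(n, k + m)]bin_small //.
  have [le_k|lt_k] := leqP k n; last by rewrite bin_small.
  by rewrite ['C(n - k, m)]bin_small ?muln0 //; lia.
have f0 : (0 < k`! * m`! * (n - (k + m))`!)%N by rewrite !muln_gt0 !fact_gt0.
apply/eqP; rewrite -(eqn_pmul2r f0); apply/eqP.
have E1 := @bin_fact n k ltac:(lia).
have E2 := @bin_fact (n - k) m ltac:(lia); rewrite -subnDA in E2.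
have E3 := bin_fact le_n.
have E4 := @bin_fact (k + m) k ltac:(lia); rewrite addKn in E4.
transitivity n`!; first by rewrite -E1 -E2; ring.
by rewrite -E3 -E4; ring.
Qed.

Lemma central_bin_rec j :
  (j.+1 * 'C(2 * j.+1, j.+1) = 2 * (2 * j + 1) * 'C(2 * j, j))%N.
Proof.
have D2 := mul_bin_diag (2 * j.+1) j.
have D1 := mul_bin_diag (2 * j).+1 j.
have L := mul_bin_left (2 * j).+1 j.
move: D2 D1 L; rewrite (_ : (2 * j.+1).-1 = (2 * j).+1)%N /=; last by lia.
rewrite (_ : (2 * j).+1 - j = j.+1)%N; last by lia.
lia.
Qed.

(** The hypothesis says that h is -1/2 in F, so 'C(h, j) is the generalized
    binomial coefficient of -1/2, as long as j`! is invertible. It is stated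
    without division so that the induction stays polynomial. *)
Lemma bin_half_central (F : fieldType) (h j : nat) :
  h.*2.+1%:R = 0 :> F -> (forall i, (0 < i <= j)%N -> i%:R != 0 :> F) ->
  'C(h, j)%:R * (- 4) ^+ j = 'C(2 * j, j)%:R :> F.
Proof.
move=> h0; elim: j => [|j IHj] nz; first by rewrite !bin0 mulr1.
have /mulfI : j.+1%:R != 0 :> F by apply: nz; lia.
apply.
have {IHj}IH : 'C(h, j)%:R * (-4) ^+ j = 'C(2 * j, j)%:R :> F.
  by apply: IHj => i ij; apply: nz; lia.
have E1 : j.+1%:R * 'C(h, j.+1)%:R = (h%:R - j%:R) * 'C(h, j)%:R :> F.
  rewrite -natrM mul_bin_left.
  have [le_j|lt_h] := leqP j h; first by rewrite natrM natrB.
  by rewrite bin_small // muln0 mulr0.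
rewrite mulrA E1 -natrM central_bin_rec 2!natrM -IH exprS.
transitivity ((- 4 * (h%:R - j%:R) + 2 * h.*2.+1%:R)
              * ('C(h, j)%:R * (- 4) ^+ j) : F); first by rewrite h0; ring.
by congr (_ * _); rewrite -addn1 -mul2n; ring.
Qed.

(** The recurrence comes from the closed form (6k)! / ((3k)! k! (2k)!). *)
Lemma bin_sextic_rec k : (k.+1 ^ 2 * ('C(6 * k.+1, 3 * k.+1) * 'C(3 * k.+1, k.+1))
   = 12 * (6 * k + 1) * (6 * k + 5) * ('C(6 * k, 3 * k) * 'C(3 * k, k)))%N.
Proof.
have E j : ('C(6 * j, 3 * j) * 'C(3 * j, j) * ((3 * j)`! * j`! * (2 * j)`!)
          = (6 * j)`!)%N.
  have := @bin_fact (3 * j) j ltac:(lia); have := @bin_fact (6 * j) (3 * j) ltac:(lia).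
  rewrite (_ : 6 * j - 3 * j = 3 * j)%N; last by lia.
  rewrite (_ : 3 * j - j = 2 * j)%N; last by lia.
  by move=> <- E3; rewrite -{2}E3; ring.
have f0 : (0 < (3 * k)`! * k`! * (2 * k)`!)%N by rewrite !muln_gt0 !fact_gt0.
have E1 := E k.+1; have {E}E0 := E k.
move: E1; rewrite (_ : 6 * k.+1 = (6 * k).+4.+2)%N; last by lia.
rewrite (_ : 3 * k.+1 = (3 * k).+3)%N; last by lia.
rewrite (_ : 2 * k.+1 = (2 * k).+2)%N; last by lia.
rewrite !factS -E0 => E1.
(* This is the common factor of the two products of consecutive integers that
   the factorials leave: (k + 1)(2k + 1)(2k + 2) is 2(2k + 1) times (k + 1)^2, and
   6k + 6, 6k + 4, 6k + 2 double 3k + 3, 3k + 2, 3k + 1, whence the 8 below. *)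
have c0 : (0 < 2 * (2 * k + 1) * (6 * k + 6) * (6 * k + 4) * (6 * k + 2))%N.
  by rewrite !muln_gt0 !addn_gt0 !orbT.
apply/eqP; rewrite -(eqn_pmul2r f0) -(eqn_pmul2l c0); apply/eqP.
transitivity (8 * ('C((6 * k).+4.+2, (3 * k).+3) * 'C((3 * k).+3, k.+1)
  * ((3 * k).+3 * ((3 * k).+2 * ((3 * k).+1 * (3 * k)`!)) * (k.+1 * k`!)
     * ((2 * k).+2 * ((2 * k).+1 * (2 * k)`!)))))%N; last by rewrite E1; ring.
by ring.
Qed.

Lemma legendre_coef_rec n k :
  (k.+1 ^ 2 * ('C(n + k.+1, 2 * k.+1) * 'C(2 * k.+1, k.+1))
   = (n - k) * (n + k.+1) * ('C(n + k, 2 * k) * 'C(2 * k, k)))%N.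
Proof.
have L := mul_bin_left (n + k) (2 * k).
rewrite (_ : (n + k - 2 * k = n - k)%N) in L; last by lia.
have D := mul_bin_diag (n + k.+1) (2 * k).+1.
rewrite (_ : ((n + k.+1).-1 = n + k)%N) in D; last by lia.
transitivity (k.+1 * 'C(n + k.+1, 2 * k.+1) * (k.+1 * 'C(2 * k.+1, k.+1)))%N.
  by ring.
rewrite central_bin_rec.
transitivity ((2 * k).+1 * ((2 * k).+2 * 'C(n + k.+1, (2 * k).+2))
              * 'C(2 * k, k))%N.
  by rewrite (_ : (2 * k.+1 = (2 * k).+2)%N); [ring | lia].
rewrite -D.
transitivity ((n + k.+1) * ((2 * k).+1 * 'C(n + k, (2 * k).+1)) * 'C(2 * k, k))%N.
  by ring.
by rewrite L; ring.
Qed.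

(** Both sides satisfy first-order recurrences in k, and the hypothesis on N
    makes 12 (6k + 1) (6k + 5) and -432 (N - k) (N + k + 1) agree. *)
Lemma legendre_coef_sextic (F : fieldType) (N k : nat) :
  36 * N%:R * N.+1%:R = - 5 :> F ->
  (forall i, (0 < i <= k)%N -> i%:R != 0 :> F) ->
  ('C(N + k, 2 * k) * 'C(2 * k, k))%:R * (- 432) ^+ k
  = ('C(6 * k, 3 * k) * 'C(3 * k, k))%:R :> F.
Proof.
move=> hN; elim: k => [|k IHk] nz; first by rewrite !bin0 mulr1.
have k0 : k.+1%:R != 0 :> F by apply: nz; lia.
apply: (mulfI (expf_neq0 2 k0)).
rewrite -[in RHS]natrX -[RHS]natrM bin_sextic_rec [RHS]natrM -IHk; last first.
  by move=> i ik; apply: nz; lia.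
have E : k.+1%:R ^+ 2 * ('C(N + k.+1, 2 * k.+1) * 'C(2 * k.+1, k.+1))%:R
  = (N%:R - k%:R) * (N%:R + k.+1%:R) * ('C(N + k, 2 * k) * 'C(2 * k, k))%:R :> F.
  rewrite -natrX -natrM legendre_coef_rec.
  have [le_k|lt_N] := leqP k N; first by rewrite 2!natrM natrB // -natrD.
  by rewrite ['C(N + k, _)]bin_small ?mul0n ?muln0 ?mulr0 //; lia.
rewrite mulrA E exprS.
suff -> : (12 * (6 * k + 1) * (6 * k + 5))%:R
    = - 432 * (N%:R - k%:R) * (N%:R + k.+1%:R) :> F by ring.
transitivity (- 12 * (36 * N%:R * N.+1%:R) + 432 * k%:R * k.+1%:R : F).
  by rewrite hN -natr1 !natrM !natrD; ring.
by rewrite -!natr1; ring.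
Qed.

(** * Legendre polynomials expanded at 1 *)

(** The three-term recurrence of the Legendre polynomials, read on the
    coefficients of ((x - 1) / 2) ^+ k.+1. Every binomial coefficient is
    expressed by those of row n.+1 + k, after which the identity is a
    combination of the recurrences for 'C(_, 2k) and for 'C(2k, k). *)
Lemma legendre_coef_contiguous n k :
  (n.+2 * ('C(n.+2 + k.+1, 2 * k.+1) * 'C(2 * k.+1, k.+1))
   + n.+1 * ('C(n + k.+1, 2 * k.+1) * 'C(2 * k.+1, k.+1))
   = (2 * n + 3) * ('C(n.+1 + k.+1, 2 * k.+1) * 'C(2 * k.+1, k.+1)
                    + 2 * ('C(n.+1 + k, 2 * k) * 'C(2 * k, k))))%N.
Proof.
have hC := central_bin_rec k.
rewrite (_ : (n.+2 + k.+1 = (n.+1 + k).+2)%N); last by lia.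
rewrite (_ : (n.+1 + k.+1 = (n.+1 + k).+1)%N); last by lia.
rewrite (_ : (n + k.+1 = n.+1 + k)%N); last by lia.
rewrite (_ : (2 * k.+1 = (2 * k).+2)%N) in hC *; last by lia.
have [le_k|lt_n] := leqP k n.+1; last first.
  by rewrite ['C((_ + _).+2, _)]bin_small ?['C((_ + _).+1, _)]bin_small
             ?['C(n.+1 + k, _)]bin_small; lia.
have hB := mul_bin_left (n.+1 + k) (2 * k).
rewrite (_ : (n.+1 + k - 2 * k = n.+1 - k)%N) in hB; last by lia.
have {hC} : k.+1%:R * 'C((2 * k).+2, k.+1)%:R
    = 2 * (2 * k%:R + 1) * 'C(2 * k, k)%:R :> rat.
  by rewrite -natrM hC 2!natrM natrD natrM.
have {hB} : (2 * k%:R + 1) * 'C(n.+1 + k, (2 * k).+1)%:R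
    = (n%:R + 1 - k%:R) * 'C(n.+1 + k, 2 * k)%:R :> rat.
  transitivity (((2 * k).+1 * 'C(n.+1 + k, (2 * k).+1))%:R : rat).
    by rewrite natrM -[(2 * k).+1%:R]natr1 natrM.
  by rewrite hB natrM natrB // -[n.+1%:R]natr1.
move: (n.+1 + k)%N 'C((2 * k).+2, k.+1) 'C(2 * k, k) => M c1 c0.
rewrite (binS M.+1) !(binS M).
move: 'C(M, 2 * k) 'C(M, (2 * k).+1) 'C(M, (2 * k).+2) => x y z hB hC.
apply/eqP; rewrite -(eqr_nat rat); apply/eqP.
have k0 : k.+1%:R != 0 :> rat by rewrite pnatr_eq0.
apply: (mulfI k0); apply/eqP; rewrite -subr_eq0; apply/eqP.
transitivity ((k.+1%:R * c1%:R - 2 * (2 * k%:R + 1) * c0%:R) * (y%:R + n.+2%:R * x%:R)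
  + 2 * c0%:R * ((2 * k%:R + 1) * y%:R - (n%:R + 1 - k%:R) * x%:R) : rat).
  by rewrite -[k.+1%:R]natr1 -[n.+2%:R]natr1 -[n.+1%:R]natr1; ring.
by rewrite hB hC !subrr mul0r mulr0 addr0.
Qed.

Lemma horner_legendre_poly n x : (legendre_poly n).[x]
  = \sum_(0 <= k < n.+1) ('C(n + k, 2 * k) * 'C(2 * k, k))%:R * ((x - 1) / 2) ^+ k.
Proof.
set u := (x - 1) / 2.
have xE : x = 1 + 2 * u by rewrite /u; field.
pose c m k : rat := ('C(m + k, 2 * k) * 'C(2 * k, k))%:R.
have c_small m k : (m < k)%N -> c m k = 0.
  by move=> lt_m; rewrite /c bin_small ?mul0n //; lia.
have c0 m : c m 0 = 1 by rewrite /c !bin0.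
pose G m : rat := \sum_(0 <= k < m.+1) c m k * u ^+ k.
(* The recurrence has order two, hence an induction on consecutive pairs. *)
suff [] : (legendre_poly n).[x] = G n /\ (legendre_poly n.+1).[x] = G n.+1 by [].
elim: n => [|n [IH0 IH1]].
  by rewrite /G !big_nat_recr //= !big_geq // hornerC hornerX !c0 xE /c /=
             !bin1 (_ : 'C(1 + 1, 2 * 1) = 1%N) //; split; ring.
split=> //; apply: (@mulfI _ n.+2%:R); first by rewrite pnatr_eq0.
rewrite -hornerZ legendre_poly_rec // hornerD hornerN !hornerZ hornerM hornerX IH0 IH1.
(* Coefficients beyond the degree vanish, so all the sums can share one range. *)
have widen m K : (m < K)%N -> G m = 1 + \sum_(0 <= k < K) c m k.+1 * u ^+ k.+1.
  move=> lt_m; have -> : G m = \sum_(0 <= k < K.+1) c m k * u ^+ k.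
    rewrite [RHS](@big_cat_nat _ _ _ m.+1) //=; last by lia.
    rewrite [X in _ = _ + X]big_nat_cond [X in _ = _ + X]big1 ?addr0 //.
    by move=> k; rewrite andbT => /andP[lt_k _]; rewrite c_small ?mul0r.
  by rewrite big_nat_recl // c0 mul1r expr0.
have shift : u * G n.+1 = \sum_(0 <= k < n.+3) c n.+1 k * u ^+ k.+1.
  rewrite [RHS]big_nat_recr //= c_small // mul0r addr0 /G mulr_sumr.
  by apply: eq_bigr => k _; rewrite exprS; ring.
rewrite (_ : x * G n.+1 = G n.+1 + 2 * (u * G n.+1)); last by rewrite xE; ring.
rewrite shift (widen n n.+3) ?(widen n.+1 n.+3) ?(widen n.+2 n.+3) //; last by lia.
set S0 := \sum_(0 <= k < _) c n _ * _; set S2 := \sum_(0 <= k < _) c n.+2 _ * _.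
set S1 := \sum_(0 <= k < _) c n.+1 _.+1 * _; set S := \sum_(0 <= k < _) _.
suff E : n.+2%:R * S2 + n.+1%:R * S0 = (2 * n + 3)%:R * (S1 + 2 * S).
  have {E} E : n.+2%:R * S2 = (2 * n + 3)%:R * (S1 + 2 * S) - n.+1%:R * S0.
    by rewrite -E addrK.
  by rewrite /= [RHS]mulrDr E -[n.+2%:R]natr1 -[n.+1%:R]natr1; ring.
rewrite /S0 /S1 /S2 /S [2 * _]mulr_sumr -[in RHS]big_split /= !mulr_sumr -big_split /=.
apply: eq_bigr => k _; rewrite !mulrA -!mulrDl mulrA; congr (_ * _).
by rewrite /c -!natrM -!natrD -natrM legendre_coef_contiguous.
Qed.

(** * Residues of p-integral rationals *)

(** The graph of the residue map from p-integral rationals to 'F_p. As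
    [ratr] into a field of positive characteristic is not a morphism, the residue
    is followed through formulas by a relation, whose closure under the field
    operations yields integrality and the value of the residue at once. The
    fraction a / b need not be reduced, which is what makes closure easy. *)
Definition reduces (p : nat) (x : rat) (r : 'F_p) : Prop :=
  exists a b : int,
    [/\ b%:~R != 0 :> 'F_p, x * b%:~R = a%:~R & r * b%:~R = a%:~R].

Lemma reduces_int p (z : int) : @reduces p z%:~R z%:~R.
Proof. by exists z, 1; rewrite oner_eq0 !mulr1. Qed.

Lemma reduces_nat p (n : nat) : @reduces p n%:R n%:R.
Proof. exact: (reduces_int p n). Qed.

Lemma reducesD p x y r s :
  @reduces p x r -> @reduces p y s -> @reduces p (x + y) (r + s).
Proof.
move=> [a [b [b0 xE rE]]] [c [d [d0 yE sE]]].
exists (a * d + c * b), (b * d).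
by rewrite !rmorphD !rmorphM /= mulf_neq0 //; split=> //;
  rewrite -?xE -?yE -?rE -?sE; ring.
Qed.

Lemma reducesN p x r : @reduces p x r -> @reduces p (- x) (- r).
Proof.
move=> [a [b [b0 xE rE]]]; exists (- a), b.
by rewrite !rmorphN /= !mulNr xE rE.
Qed.

Lemma reducesB p x y r s :
  @reduces p x r -> @reduces p y s -> @reduces p (x - y) (r - s).
Proof. by move=> xr ys; apply: reducesD => //; apply: reducesN. Qed.

Lemma reducesM p x y r s :
  @reduces p x r -> @reduces p y s -> @reduces p (x * y) (r * s).
Proof.
move=> [a [b [b0 xE rE]]] [c [d [d0 yE sE]]].
exists (a * c), (b * d).
by rewrite !rmorphM /= mulf_neq0 //; split=> //;
  rewrite -?xE -?yE -?rE -?sE; ring.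
Qed.

Lemma reducesX p x r k : @reduces p x r -> @reduces p (x ^+ k) (r ^+ k).
Proof.
move=> xr; elim: k => [|k IHk]; first exact: (reduces_nat p 1).
by rewrite !exprS; apply: reducesM.
Qed.

Lemma reducesV p x r : r != 0 -> @reduces p x r -> @reduces p x^-1 r^-1.
Proof.
move=> r0 [a [b [b0 xE rE]]].
have a0 : a%:~R != 0 :> 'F_p by rewrite -rE mulf_neq0.
have a0Q : a%:~R != 0 :> rat.
  by apply: contraNneq a0 => /eqP; rewrite intr_eq0 => /eqP->.
have x0 : x != 0 by apply: contraNneq a0Q => x0; rewrite -xE x0 mul0r.
by exists b, a; rewrite -rE -xE !mulKf ?rE.
Qed.

Lemma reduces_sum p n (x : nat -> rat) (r : nat -> 'F_p) :
  (forall k, (k < n)%N -> reduces (x k) (r k)) ->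
  reduces (\sum_(0 <= k < n) x k) (\sum_(0 <= k < n) r k).
Proof.
elim: n => [|n IHn] xr; first by rewrite !big_geq //; exact: (reduces_nat p 0).
rewrite !big_nat_recr //=; apply: reducesD; last exact: xr.
by apply: IHn => k ltk; apply: xr; rewrite ltnS ltnW.
Qed.

Lemma reduces_inj p x (r s : 'F_p) : reduces x r -> reduces x s -> r = s.
Proof.
move=> [a [b [b0 xE rE]]] [c [d [d0 yE sE]]].
have ab : a * d = c * b.
  by apply/eqP; rewrite -(eqr_int rat) !rmorphM /= -xE -yE; apply/eqP; ring.
apply: (mulIf (mulf_neq0 b0 d0)); rewrite mulrA rE -rmorphM ab rmorphM /= -sE.
by ring.
Qed.

Lemma intr_Fp_eq0 p (z : int) :
  prime p -> (z%:~R == 0 :> 'F_p) = (p %| `|z|)%N.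
Proof. by move=> p_prime; rewrite -(dvdz_pcharf (pchar_Fp p_prime)). Qed.

Lemma Rp_denq p x : prime p -> (x \in Rp p) = ((denq x)%:~R != 0 :> 'F_p).
Proof.
by move=> p_prime; rewrite intr_Fp_eq0 // inE coprime_sym prime_coprime.
Qed.

Lemma reduces_mem p x (r : 'F_p) : prime p -> reduces x r -> x \in Rp p.
Proof.
move=> p_prime [a [b [b0 xE _]]]; rewrite Rp_denq //.
apply: contraNneq b0 => d0.
have ab : numq x * b = a * denq x.
  by apply/eqP; rewrite -(eqr_int rat) !rmorphM /= -xE numqE; apply/eqP; ring.
have : (`|denq x| %| `|numq x| * `|b|)%N by rewrite -abszM ab abszM dvdn_mull.
rewrite Gauss_dvdr; last by rewrite coprime_sym coprime_num_den.
by rewrite intr_Fp_eq0 //; apply: dvdn_trans; rewrite -intr_Fp_eq0 // d0.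
Qed.

Lemma Rp_reduces p x : prime p -> x \in Rp p -> reduces x (ratr x : 'F_p).
Proof.
move=> p_prime; rewrite Rp_denq // => d0; exists (numq x), (denq x).
by rewrite -numqE /ratr mulfVK.
Qed.

(** The difference has residue 0, so its numerator absorbs the division by p. *)
Lemma reduces_congr p x y (r : 'F_p) :
  prime p -> reduces x r -> reduces y r -> x =_[p] y.
Proof.
move=> p_prime xr yr; rewrite /congr_Rp (reduces_mem p_prime xr).
rewrite (reduces_mem p_prime yr) /=.
have [a [b [b0 xE /eqP]]] := reducesB xr yr.
rewrite subrr mul0r eq_sym -(dvdz_pcharf (pchar_Fp p_prime)) => /dvdzP[c aE].
have p0 : p%:R != 0 :> rat by rewrite pnatr_eq0 -lt0n prime_gt0.
apply: (reduces_mem (r := c%:~R / b%:~R)) => //.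
exists c, b; split=> //; last by rewrite divfK.
by apply: (mulIf p0); rewrite mulrAC divfK // xE aE intrM pmulrn.
Qed.

(** * The two identities in the prime field *)

Lemma natr_Fp_neq0 p i : prime p -> (0 < i < p)%N -> i%:R != 0 :> 'F_p.
Proof.
move=> p_prime /andP[i0 ip].
by rewrite -(dvdn_pcharf (pchar_Fp p_prime)) gtnNdvd.
Qed.

(** The numerical denominators 12, 64 and 1728 have no other prime factors. *)
Lemma natr_Fp_smooth_neq0 p a b : prime p -> (3 < p)%N ->
  (2 ^ a * 3 ^ b)%:R != 0 :> 'F_p.
Proof.
move=> p_prime p_gt3; rewrite natrM !natrX.
by rewrite mulf_neq0 ?expf_neq0 //; apply: (@natr_Fp_neq0 _ _ p_prime); lia.
Qed.

Lemma prime_gt3_mod6 p : prime p -> (3 < p)%N ->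
  p = (6 * (p %/ 6) + 1)%N \/ p = (6 * (p %/ 6) + 5)%N.
Proof.
move=> p_prime p_gt3.
have N2 : ~~ (2 %| p)%N by rewrite dvdn_prime2 //; lia.
have N3 : ~~ (3 %| p)%N by rewrite dvdn_prime2 //; lia.
lia.
Qed.

Lemma prime_odd_half p : prime p -> (2 < p)%N -> p = (p./2).*2.+1.
Proof.
move=> p_prime p_gt2.
have p_odd : odd p by case: (even_prime p_prime) => // p2; rewrite p2 in p_gt2.
by rewrite -{1}(odd_double_half p) p_odd.
Qed.

Lemma sum_Fp p (G : 'F_p -> 'F_p) : prime p ->
  \sum_(0 <= x < p) G x%:R = \sum_(x : 'F_p) G x.
Proof.
move=> p_prime.
transitivity (\sum_(0 <= x < (Zp_trunc (pdiv p)).+2) G x%:R).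
  by congr bigop; rewrite Fp_cast.
rewrite big_mkord.
by apply: eq_bigr => x _; rewrite natr_Zp.
Qed.

(** Euler's criterion; the zero value of the symbol is the power 0 ^+ p./2. *)
Lemma legendre_symbol_expf (p : nat) (a : rat) : prime p -> (2 < p)%N ->
  (legendre_symbol p a)%:~R = (ratr a : 'F_p) ^+ p./2 :> 'F_p.
Proof.
move=> p_prime p_gt2; rewrite /legendre_symbol; set r : 'F_p := ratr a.
have pE := prime_odd_half p_prime p_gt2.
have card_F : #|'F_p| = (p./2).*2.+1 by rewrite card_Fp -?pE.
have [->|r0] := eqVneq r 0.
  by rewrite expr0n; case: (p./2) pE => // p0; lia.
case: ifP => [/existsP[y /eqP yr]|no_sqrt].
  rewrite -yr -exprM mul2n [RHS](_ : _ = y ^+ #|'F_p|.-1); last by rewrite card_F.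
  rewrite expf_card_pred //; apply: contraNneq r0 => y0.
  by rewrite -yr y0 expr0n.
have : (r ^+ p./2) ^+ 2 = 1.
  by rewrite -exprM muln2 -[_.*2]/(_.*2.+1.-1) -card_F expf_card_pred.
move/eqP; rewrite sqrf_eq1 => /orP[/eqP|/eqP->//].
case/(square_of_expf_eq1 card_F) => y ry.
by move/existsP: no_sqrt; case; exists y; rewrite ry.
Qed.

(** The factor -432 turns the argument of the binomial sum into the one
    at which a Legendre polynomial is expanded. The relation 36 N(N + 1) = -5 for
    N = [p / 6] is (6N + 1)(6N + 5) = 0, one of the factors being p. *)
Lemma legendre_sextic_Fp p (u : 'F_p) : prime p -> (3 < p)%N ->
  \sum_(0 <= k < (p %/ 6).+1)
     ('C(p %/ 6 + k, 2 * k) * 'C(2 * k, k))%:R * (- 432 * u) ^+ k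
  = \sum_(0 <= k < (p %/ 6).+1) ('C(6 * k, 3 * k) * 'C(3 * k, k))%:R * u ^+ k.
Proof.
move=> p_prime p_gt3; apply: eq_big_nat => k ltk.
rewrite exprMn mulrA legendre_coef_sextic //; last first.
  by move=> i ik; apply: natr_Fp_neq0 => //; lia.
set N := (p %/ 6)%N.
have: (6 * N + 1)%:R * (6 * N + 5)%:R = 0 :> 'F_p.
  have p0 : p%:R = 0 :> 'F_p := pcharf0 (pchar_Fp p_prime).
  by case: (prime_gt3_mod6 p_prime p_gt3) => <-; rewrite p0 ?mul0r ?mulr0.
move=> E; apply/eqP; rewrite -subr_eq0 -E -[N.+1%:R]natr1; apply/eqP; ring.
Qed.

(** In the power of the cubic, the factor (x ^+ 2) ^+ (h - k) of the term of
    d ^+ k shifts the sought degree #|F| - 1 = 2h down to degree 2k in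
    (x + c) ^+ (h - k), where one monomial contributes. *)
Lemma sum_nodal_cubic_exp (F : finFieldType) (c d : F) (h : nat) :
    #|F| = h.*2.+1 ->
  \sum_(x : F) (x ^+ 2 * (x + c) + d) ^+ h
  = - \sum_(0 <= k < (h %/ 3).+1)
        ('C(h, 3 * k) * 'C(3 * k, k))%:R * c ^+ (h - 3 * k) * d ^+ k.
Proof.
move=> card_F.
pose f : {poly F} := ('X^2 * ('X + c%:P) + d%:P) ^+ h.
have sf : (size f <= #|F|.-1.*2)%N.
  apply: leq_trans (size_poly_exp_leq _ _) _.
  suff: (size ('X^2 * ('X + c%:P) + d%:P)%R <= 4)%N.
    rewrite card_F /= => size4.
    have h_gt0 : (0 < h)%N by have := finNzRing_gt1 F; rewrite card_F; lia.
    apply: (@leq_ltn_trans (3 * h)); last by lia.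
    by rewrite leq_mul2r; apply/orP; right; lia.
  apply: leq_trans (size_polyD _ _) _; rewrite geq_max.
  apply/andP; split; last exact: leq_trans (size_polyC_leq1 _) _.
  by apply: leq_trans (size_polyMleq _ _) _; rewrite size_polyXn size_XaddC.
transitivity (\sum_x f.[x]).
  by apply: eq_bigr => x _; rewrite /f !hornerE.
rewrite sum_finField_horner // card_F /=; congr (- _).
rewrite /f exprDn coef_sum -(big_mkord xpredT (fun k =>
  (('X^2 * ('X + c%:P)) ^+ (h - k) * d%:P ^+ k *+ 'C(h, k))`_h.*2)).
have le_h : (h %/ 3 <= h)%N by lia.
have coef_term k : (k <= h)%N ->
    (('X^2 * ('X + c%:P)) ^+ (h - k) * d%:P ^+ k *+ 'C(h, k))`_h.*2
    = ('C(h, 3 * k) * 'C(3 * k, k))%:R * c ^+ (h - 3 * k) * d ^+ k.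
  move=> le_k; rewrite coefMn -polyC_exp coefMC exprMn -exprM coefXnM.
  rewrite ltnNge (_ : (2 * (h - k) <= h.*2)%N) /=; last by lia.
  rewrite (_ : h.*2 - 2 * (h - k) = 2 * k)%N; last by lia.
  (* When 3k exceeds h, the degree 2k is too large for ('X + c) ^+ (h - k). *)
  have [le_3k|lt_h] := leqP (3 * k) h; last first.
    rewrite [_`_(2 * k)]nth_default ?mul0r ?mul0rn; last first.
      by rewrite (leq_trans (size_poly_exp_leq _ _)) // size_XaddC /=; lia.
    by rewrite bin_small // !mul0r.
  rewrite addrC exprDn coef_sum.
  have lt_2k : (2 * k < (h - k).+1)%N by lia.
  rewrite (bigD1 (Ordinal lt_2k)) //= big1 => [|i]; last first.
    rewrite -val_eqE /= => i_neq.
    by rewrite -polyC_exp coefMn coefCM coefXn eq_sym (negPf i_neq) mulr0 mul0rn.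
  rewrite addr0 coefMn -polyC_exp coefCM coefXn eqxx mulr1.
  rewrite (_ : (h - k - 2 * k = h - 3 * k)%N); last by lia.
  have -> : ('C(h, 3 * k) * 'C(3 * k, k) = 'C(h, k) * 'C(h - k, 2 * k))%N.
    by rewrite bin_mul_trinomial (_ : (k + 2 * k = 3 * k)%N) //; lia.
  by rewrite natrM -mulr_natl -[_ *+ 'C(h - k, 2 * k)]mulr_natl; ring.
rewrite (@big_cat_nat _ _ _ (h %/ 3).+1) //=.
rewrite [X in _ + X]big_nat_cond [X in _ + X]big1 ?addr0.
  by apply: eq_big_nat => k /andP[_ lek]; apply: coef_term; lia.
move=> k; rewrite andbT => /andP[ltk lek].
by rewrite coef_term // bin_small ?mul0n ?mul0r //; lia.
Qed.

(** The translation by m exhibits the cubic as a constant away from a nodal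
    one. The two factors (3 * m) ^+ h then multiply to 1, which leaves powers of
    (3 * m) ^- 3. *)
Lemma sum_cubic_exp_Fp p (m n : 'F_p) : prime p -> (3 < p)%N -> m != 0 ->
  - (3 * m) ^+ p./2 * \sum_(x : 'F_p) (x ^+ 3 - 3 * m ^+ 2 * x + n) ^+ p./2
  = \sum_(0 <= k < (p %/ 6).+1) ('C(6 * k, 3 * k) * 'C(3 * k, k))%:R
      * ((2 * m ^+ 3 - n) / (12 ^+ 3 * m ^+ 3)) ^+ k.
Proof.
move=> p_prime p_gt3 m0; set h := p./2.
have pE : p = h.*2.+1 by apply: prime_odd_half => //; lia.
have card_F : #|'F_p| = h.*2.+1 by rewrite card_Fp.
have smooth := natr_Fp_smooth_neq0 _ _ p_prime p_gt3.
have three0 : 3 != 0 :> 'F_p := smooth 0 1.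
have c0 : 3 * m != 0 by rewrite mulf_neq0.
have ch : (3 * m) ^+ h * (3 * m) ^+ h = 1.
  by rewrite -exprD addnn -[h.*2]/(h.*2.+1.-1) -card_F expf_card_pred.
rewrite (reindex_inj (addIr m)) /=.
under eq_bigr => y _.
  rewrite (_ : _ + n = y ^+ 2 * (y + 3 * m) + (n - 2 * m ^+ 3)); last by ring.
  over.
rewrite sum_nodal_cubic_exp // mulrNN (_ : h %/ 3 = p %/ 6)%N; last by lia.
rewrite mulr_sumr; apply: eq_big_nat => k /andP[_ ltk].
have le_3k : (3 * k <= h)%N by lia.
rewrite 2!natrM -(_ : 2 * (3 * k) = 6 * k)%N; last by lia.
rewrite -(bin_half_central (h := h)); last first.
- by move=> i ik; apply: natr_Fp_neq0 => //; lia.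
- by rewrite -pE pcharf0 // pchar_Fp.
have -> : (3 * m) ^+ (h - 3 * k) = (3 * m) ^+ h / ((3 * m) ^+ 3) ^+ k.
  by rewrite -exprM -{2}(subnK le_3k) exprD mulfK // expf_neq0.
have -> : (2 * m ^+ 3 - n) / (12 ^+ 3 * m ^+ 3)
   = (- 4) ^- 3 * ((n - 2 * m ^+ 3) / (3 * m) ^+ 3).
  have nz64 : 64 != 0 :> 'F_p := smooth 6 0.
  have nz1728 : 1728 != 0 :> 'F_p := smooth 6 3.
  by field; rewrite m0 three0 oppr_eq0 nz64 nz1728.
have v0 : (-4) ^+ (3 * k) != 0 :> 'F_p.
  by rewrite expf_neq0 // oppr_eq0; exact: (smooth 2 0).
rewrite [(_ * (_ / _)) ^+ k]exprMn exprVn -[_ ^+ 3 ^+ k in X in X^-1 * _]exprM.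
rewrite [(_ / _) ^+ k]exprMn exprVn.
move: ((3 * m) ^+ h) ((-4) ^+ (3 * k)) ((n - _) ^+ k) (_ ^+ 3 ^+ k)^-1 v0 ch.
move=> P v d w v0 P2.
transitivity (P * P * ('C(h, 3 * k)%:R * 'C(3 * k, k)%:R * (d * w))).
  by ring.
transitivity (v / v * ('C(h, 3 * k)%:R * 'C(3 * k, k)%:R * (d * w))).
  by rewrite P2 divff.
by ring.
Qed.

Theorem theorem2p2 (p : nat) (m n : rat) (p_prime : prime p) (p_gt3 : (3 < p)%N)
    (mRp : m \in Rp p) (nRp : n \in Rp p) (m_neq0 : ~~ (m =_[p] 0)) :
  let S : rat :=
    \sum_(0 <= k < (p %/ 6).+1)
      ('C(6 * k, 3 * k) * 'C(3 * k, k))%:R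
      * ((2 * m ^+ 3 - n) / (12 ^+ 3 * m ^+ 3)) ^+ k in
  (legendre_poly (p %/ 6)).[n / (2 * m ^+ 3)] =_[p] S
  /\ S =_[p]
     (- legendre_symbol p (3 * m)
      * \sum_(0 <= x < p)
          legendre_symbol p (x%:R ^+ 3 - 3 * m ^+ 2 * x%:R + n))%:~R.
Proof.
move=> S.
have m_red := Rp_reduces p_prime mRp; have n_red := Rp_reduces p_prime nRp.
set mu : 'F_p := ratr m in m_red; set nu : 'F_p := ratr n in n_red.
have mu0 : mu != 0.
  apply: contraNneq m_neq0 => mu0; rewrite mu0 in m_red.
  exact: (reduces_congr p_prime m_red (reduces_nat p 0)).
have smooth := natr_Fp_smooth_neq0 _ _ p_prime p_gt3.
have two0 : 2 != 0 :> 'F_p := smooth 1 0.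
have twelve0 : 12 != 0 :> 'F_p := smooth 2 1.
have nz1728 : 1728 != 0 :> 'F_p := smooth 6 3.
have mu3 : mu ^+ 3 != 0 by rewrite expf_neq0.
have red2 : reduces 2 (2 : 'F_p) := reduces_nat p 2.
have red3 : reduces 3 (3 : 'F_p) := reduces_nat p 3.
have red12 : reduces 12 (12 : 'F_p) := reduces_nat p 12.
have S_red : reduces S (\sum_(0 <= k < (p %/ 6).+1)
    ('C(6 * k, 3 * k) * 'C(3 * k, k))%:R
      * ((2 * mu ^+ 3 - nu) / (12 ^+ 3 * mu ^+ 3)) ^+ k).
  apply: reduces_sum => k _; apply: reducesM; first exact: reduces_nat.
  apply: reducesX; apply: reducesM.
    by apply: reducesB => //; apply: reducesM => //; apply: reducesX.
  apply: reducesV; first by rewrite mulf_neq0 ?expf_neq0.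
  by apply: reducesM; apply: reducesX.
split; [apply: (reduces_congr p_prime _ S_red)
       | apply: (reduces_congr p_prime S_red)].
  rewrite horner_legendre_poly -legendre_sextic_Fp //.
  apply: reduces_sum => k _; apply: reducesM; first exact: reduces_nat.
  apply: reducesX.
  have -> : -432 * ((2 * mu ^+ 3 - nu) / (12 ^+ 3 * mu ^+ 3))
    = (nu / (2 * mu ^+ 3) - 1) / 2.
    by field; rewrite two0 mu0 nz1728.
  apply: reducesM; last exact: reducesV.
  apply: reducesB; last exact: (reduces_nat p 1).
  apply: reducesM => //; apply: reducesV; first by rewrite mulf_neq0.
  by apply: reducesM => //; apply: reducesX.
have ratrE x r : reduces x r -> ratr x = r :> 'F_p.
  by move=> xr; apply: (reduces_inj _ xr); apply: Rp_reduces => //;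
     exact: reduces_mem xr.
rewrite -sum_cubic_exp_Fp // -sum_Fp //.
rewrite -[X in reduces _ X](_ : (- legendre_symbol p (3 * m)
      * \sum_(0 <= x < p)
          legendre_symbol p (x%:R ^+ 3 - 3 * m ^+ 2 * x%:R + n))%:~R = _).
  exact: reduces_int.
rewrite rmorphM rmorphN rmorph_sum /= legendre_symbol_expf //; last by lia.
rewrite (ratrE (3 * m) (3 * mu)); last exact: reducesM.
congr (_ * _); apply: eq_big_nat => x _.
rewrite legendre_symbol_expf //; last by lia.
congr (_ ^+ _); apply: ratrE; apply: reducesD => //.
have x_red := reduces_nat p x.
apply: reducesB; first exact: reducesX.
by apply: reducesM => //; apply: reducesM => //; apply: reducesX.
Qed.
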